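(* Let $\gamma$ be a regular curve in $\mathbb{S}^2_+$, $\gamma(t)=\Psi(u(t),v(t))$. Then $\gamma$ is an extrinsic spherical catenary (with parameter $\lambda\in\mathbb{R}$) if and only if its geodesic curvature $\kappa_s$ satisfies $$\kappa_s=\frac{v'(\cos u)^2}{(\sin u+\lambda)\,|\gamma'|},$$ or equivalently, if $$\kappa_s=\frac{\langle\mathbf{n},\partial_z\rangle}{\sin u+\lambda},$$ where $\mathbf{n}$ is the unit normal vector of $\gamma$ in $\mathbb{S}^2$.
   Context: $\mathbb{S}^2=\{(x,y,z)\in\mathbb{R}^3: x^2+y^2+z^2=1\}$ and $\mathbb{S}^2_+=\{(x,y,z)\in\mathbb{S}^2: z>0\}$. The parametrization is $\Psi(u,v)=(\cos u\cos v,\cos u\sin v,\sin u)$; for curves $\gamma=\Psi(u,v):[a,b]\to\mathbb{S}^2_+$ one has $u(t)\in(0,\pi/2]$. Regular means $\gamma'(t)\neq0$ for all $t$; $|\gamma'|=\sqrt{u'^2+v'^2\cos^2u}$, $\langle\cdot,\cdot\rangle$ is the Euclidean inner product and $\partial_z=(0,0,1)$. Note that $\sin u$ is the Euclidean height $z$ of $\Psi(u,v)$ over the plane $z=0$. The (extrinsic) potential energy of $\gamma$ is $$\mathcal{E}^{ex}_S[\gamma]=\int_a^b(\sin u+\lambda)|\gamma'(t)|\,dt=\int_a^b(\sin u+\lambda)\sqrt{u'^2+v'^2\cos^2u}\,dt,$$ where $\lambda\in\mathbb{R}$ is a constant (a Lagrange multiplier). An extrinsic spherical catenary is a critical point of $\mathcal{E}^{ex}_S$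 (for variations in $\mathbb{S}^2$ with fixed endpoints), i.e. $(u,v)$ satisfies both Euler–Lagrange equations of the Lagrangian $J=(\sin u+\lambda)\sqrt{u'^2+v'^2\cos^2u}$. With the orientation $N(p)=-p$ of $\mathbb{S}^2$: $\mathbf{n}=\dfrac{\gamma\times\gamma'}{|\gamma'|}$ and $\kappa_s=\dfrac{\langle\gamma,\gamma'\times\gamma''\rangle}{|\gamma'|^3}$. *)

(* Defs.v *)
From Stdlib Require Import Reals Lra.
From Coquelicot Require Import Coquelicot.
Open Scope R_scope.

Definition vec3 : Type := (R * R * R)%type.

Definition cx (p : vec3) : R := fst (fst p).
Definition cy (p : vec3) : R := snd (fst p).
Definition cz (p : vec3) : R := snd p.

Definition vzero : vec3 := (0, 0, 0).
Definition dz : vec3 := (0, 0, 1).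

Definition scal3 (k : R) (p : vec3) : vec3 := (k * cx p, k * cy p, k * cz p).
Definition dot3 (p q : vec3) : R := cx p * cx q + cy p * cy q + cz p * cz q.
Definition norm3 (p : vec3) : R := sqrt (dot3 p p).
Definition cross3 (p q : vec3) : vec3 :=
  (cy p * cz q - cz p * cy q,
   cz p * cx q - cx p * cz q,
   cx p * cy q - cy p * cx q).

Definition Derive3 (g : R -> vec3) (t : R) : vec3 :=
  (Derive (fun s => cx (g s)) t,
   Derive (fun s => cy (g s)) t,
   Derive (fun s => cz (g s)) t).

Definition S2_plus (p : vec3) : Prop := dot3 p p = 1 /\ 0 < cz p.

Definition Psi (u v : R) : vec3 := (cos u * cos v, cos u * sin v, sin u).

Definition curve (u v : R -> R) (t : R) : vec3 := Psi (u t) (v t).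

Lemma Psi_S2_plus (u v : R) : 0 < u <= PI / 2 -> S2_plus (Psi u v).
Proof.
intros [Hu0 Hu1]; unfold S2_plus, Psi, dot3, cx, cy, cz; simpl; split.
- generalize (sin2_cos2 u) (sin2_cos2 v); unfold Rsqr; intros Hu Hv.
  replace (cos u * cos v * (cos u * cos v) + cos u * sin v * (cos u * sin v)
           + sin u * sin u)
    with (cos u * cos u * (sin v * sin v + cos v * cos v) + sin u * sin u)
    by ring.
  rewrite Hv; lra.
- apply sin_gt_0; generalize PI_RGT_0; lra.
Qed.

(* [f] is of class C^2 on an open neighbourhood of [a, b]. Every C^2 function
   on the closed interval (one-sided derivatives at the ends) extends to such
   an [f], and the values of f, f', f'' on [a, b] do not depend on the
   extension. *)
Definition C2_on (a b : R) (f : R -> R) : Prop :=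
  forall t, a <= t <= b ->
    locally t (fun s => ex_derive f s /\ ex_derive (Derive f) s /\
                        continuous (Derive (Derive f)) s).

Definition regular_on (a b : R) (g : R -> vec3) : Prop :=
  forall t, a <= t <= b -> Derive3 g t <> vzero.

(* Euler-Lagrange equations on [a, b] of a Lagrangian L(x, y, p, q), where p
   and q stand for x' and y'. *)
Definition Euler_Lagrange_on (L : R -> R -> R -> R -> R) (a b : R)
    (x y : R -> R) : Prop :=
  forall t, a <= t <= b ->
    is_derive
      (fun s => Derive (fun p => L (x s) (y s) p (Derive y s)) (Derive x s)) t
      (Derive (fun w => L w (y t) (Derive x t) (Derive y t)) (x t))
    /\
    is_derive
      (fun s => Derive (fun q => L (x s) (y s) (Derive x s) q) (Derive y s)) t
      (Derive (fun w => L (x t) w (Derive x t) (Derive y t)) (y t)).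

(* The integrand of the potential energy: energy = int_a^b J(u, v, u', v') dt. *)
Definition J (lambda u v p q : R) : R :=
  (sin u + lambda) * sqrt (p ^ 2 + q ^ 2 * (cos u) ^ 2).

Definition extrinsic_spherical_catenary (lambda a b : R) (u v : R -> R) : Prop :=
  Euler_Lagrange_on (J lambda) a b u v.

Definition unit_normal (g : R -> vec3) (t : R) : vec3 :=
  scal3 (/ norm3 (Derive3 g t)) (cross3 (g t) (Derive3 g t)).

Definition geodesic_curvature (g : R -> vec3) (t : R) : R :=
  dot3 (g t) (cross3 (Derive3 g t) (Derive3 (Derive3 g) t))
  / (norm3 (Derive3 g t)) ^ 3.

(* Main.v *)
Require Import Defs.
From Stdlib Require Import Reals Lra Classical.
From Coquelicot Require Import Coquelicot.
Open Scope R_scope.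

(** Write c = cos u, w = sin u + lambda, E = |gamma'|, kappa_s = K / E^3, and
    D = w K - v' c^2 E^2.  The defects of the two Euler-Lagrange equations are
    v' c D / E^3 and - u' c D / E^3.  Since E <> 0, the curve is a catenary iff
    c D = 0.  As u attains its maximal value pi/2 only at the ends of the
    interval (at an interior point both u' and cos u would vanish), continuity
    turns this into D = 0.

    Where w <> 0, D = 0 is the curvature equation.  At a zero of w the
    convention / 0 = 0 makes it read K = 0, and D = 0 must be compared with that
    globally: if w vanishes on an interval then u' = 0 there, hence
    K = v'^3 c^2 sin u <> 0, which the curvature equation excludes.  So D = 0
    follows by continuity.  Conversely the first integral w v' c^2 / E vanishes
    identically as soon as w has a zero, so near that zero either v' = 0, which
    forces K = 0, or w = 0 on an interval, which D = 0 excludes. *)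

(** * The curve and its geodesic curvature in the coordinates (u, v) *)

Definition speed_sq (u v : R -> R) (t : R) : R :=
  Derive u t ^ 2 + Derive v t ^ 2 * cos (u t) ^ 2.

(** K, the triple product of gamma, gamma' and gamma''. The angle v enters only through its
    derivatives, by invariance under rotation about the z-axis. *)
Definition curvature_num (u v : R -> R) (t : R) : R :=
  (Derive (Derive u) t * Derive v t - Derive u t * Derive (Derive v) t) * cos (u t)
  + 2 * Derive u t ^ 2 * Derive v t * sin (u t)
  + Derive v t ^ 3 * cos (u t) ^ 2 * sin (u t).

(** D, the difference of the two sides of the curvature equation after multiplication by w E^3. *)
Definition EL_defect (lambda : R) (u v : R -> R) (t : R) : R :=
  (sin (u t) + lambda) * curvature_num u v t
  - Derive v t * cos (u t) ^ 2 * speed_sq u v t.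

(** The body of [C2_on] at a single time, so that a hypothesis [C2_on] applied to a time has this
    type by conversion. *)
Definition C2_at (f : R -> R) (t : R) : Prop :=
  locally t (fun s => ex_derive f s /\ ex_derive (Derive f) s /\
                      continuous (Derive (Derive f)) s).

Lemma sin_sq (x : R) : sin x ^ 2 = 1 - cos x ^ 2.
Proof. generalize (sin2_cos2 x); unfold Rsqr; intros; lra. Qed.

Lemma Derive3_curve (u v : R -> R) (t : R) :
  ex_derive u t -> ex_derive v t ->
  Derive3 (curve u v) t =
    (- sin (u t) * Derive u t * cos (v t) - cos (u t) * sin (v t) * Derive v t,
     - sin (u t) * Derive u t * sin (v t) + cos (u t) * cos (v t) * Derive v t,
     cos (u t) * Derive u t).
Proof.
intros Hu Hv; unfold Derive3, curve, Psi, cx, cy, cz; simpl.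
f_equal; [f_equal|]; apply is_derive_unique; auto_derive; try tauto;
  change (fun x => u x) with u; change (fun x => v x) with v; ring.
Qed.

Lemma norm3_Derive3_curve (u v : R -> R) (t : R) :
  ex_derive u t -> ex_derive v t ->
  norm3 (Derive3 (curve u v) t) = sqrt (speed_sq u v t).
Proof.
intros Hu Hv; rewrite Derive3_curve by assumption.
unfold norm3, dot3, speed_sq, cx, cy, cz; simpl fst; simpl snd; f_equal.
generalize (sin_sq (u t)) (sin_sq (v t)); intros H1 H2; ring [H1 H2].
Qed.

Lemma Derive3_Derive3_curve (u v : R -> R) (t : R) :
  C2_at u t -> C2_at v t ->
  Derive3 (Derive3 (curve u v)) t =
    (- cos (u t) * Derive u t ^ 2 * cos (v t) - sin (u t) * Derive (Derive u) t * cos (v t)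
     + 2 * sin (u t) * Derive u t * sin (v t) * Derive v t
     - cos (u t) * cos (v t) * Derive v t ^ 2 - cos (u t) * sin (v t) * Derive (Derive v) t,
     - cos (u t) * Derive u t ^ 2 * sin (v t) - sin (u t) * Derive (Derive u) t * sin (v t)
     - 2 * sin (u t) * Derive u t * cos (v t) * Derive v t
     - cos (u t) * sin (v t) * Derive v t ^ 2 + cos (u t) * cos (v t) * Derive (Derive v) t,
     - sin (u t) * Derive u t ^ 2 + cos (u t) * Derive (Derive u) t).
Proof.
intros Hu Hv.
assert (Hloc : locally t (fun s => ex_derive u s /\ ex_derive v s)).
{ generalize (filter_and _ _ Hu Hv); apply filter_imp; tauto. }
destruct (locally_singleton _ _ Hu) as [Hu1 [Hu2 _]].
destruct (locally_singleton _ _ Hv) as [Hv1 [Hv2 _]].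
unfold Derive3 at 1.
rewrite
  (Derive_ext_loc (fun s => cx (Derive3 (curve u v) s))
     (fun s => - sin (u s) * Derive u s * cos (v s) - cos (u s) * sin (v s) * Derive v s)),
  (Derive_ext_loc (fun s => cy (Derive3 (curve u v) s))
     (fun s => - sin (u s) * Derive u s * sin (v s) + cos (u s) * cos (v s) * Derive v s)),
  (Derive_ext_loc (fun s => cz (Derive3 (curve u v) s))
     (fun s => cos (u s) * Derive u s));
  try (generalize Hloc; apply filter_imp; intros s [Hs1 Hs2];
       rewrite Derive3_curve by assumption; reflexivity).
f_equal; [f_equal|]; apply is_derive_unique; auto_derive; try tauto;
  change (fun x => u x) with u; change (fun x => v x) with v;
  change (fun x => Derive u x) with (Derive u);
  change (fun x => Derive v x) with (Derive v); ring.
Qed.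

Lemma geodesic_curvature_curve (u v : R -> R) (t : R) :
  C2_at u t -> C2_at v t ->
  geodesic_curvature (curve u v) t = curvature_num u v t / sqrt (speed_sq u v t) ^ 3.
Proof.
intros Hu Hv; unfold geodesic_curvature.
destruct (locally_singleton _ _ Hu) as [Hu1 _].
destruct (locally_singleton _ _ Hv) as [Hv1 _].
rewrite norm3_Derive3_curve, Derive3_Derive3_curve, Derive3_curve by assumption.
f_equal; unfold curve, Psi, dot3, cross3, curvature_num, cx, cy, cz.
simpl fst; simpl snd.
generalize (sin_sq (u t)) (sin_sq (v t)); intros H1 H2; ring [H1 H2].
Qed.

Lemma dot3_unit_normal_curve (u v : R -> R) (t : R) :
  ex_derive u t -> ex_derive v t ->
  dot3 (unit_normal (curve u v) t) dz
  = Derive v t * cos (u t) ^ 2 / norm3 (Derive3 (curve u v) t).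
Proof.
intros Hu Hv; unfold unit_normal.
(* The norm enters both sides only as the factor [/ N]; what remains is the z-component of gamma x
   gamma'. *)
generalize (norm3 (Derive3 (curve u v) t)); intros N.
rewrite Derive3_curve by assumption.
unfold curve, Psi, dot3, cross3, scal3, dz, cx, cy, cz, Rdiv; simpl fst; simpl snd.
generalize (sin_sq (v t)); intros H; ring [H].
Qed.

(** * Partial derivatives of the Lagrangian and the Euler-Lagrange equations at one time *)

Lemma Derive_J_p (lambda x y p q : R) : 0 < p ^ 2 + q ^ 2 * cos x ^ 2 ->
  Derive (fun p => J lambda x y p q) p
  = (sin x + lambda) * p / sqrt (p ^ 2 + q ^ 2 * cos x ^ 2).
Proof.
intros H; apply is_derive_unique; unfold J; auto_derive.
- simpl in H |- *; lra.
- replace (p * (p * 1) + q * (q * 1) * (cos x * (cos x * 1)))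
    with (p ^ 2 + q ^ 2 * cos x ^ 2) by ring.
  field; apply Rgt_not_eq, sqrt_lt_R0, H.
Qed.

Lemma Derive_J_q (lambda x y p q : R) : 0 < p ^ 2 + q ^ 2 * cos x ^ 2 ->
  Derive (fun q => J lambda x y p q) q
  = (sin x + lambda) * q * cos x ^ 2 / sqrt (p ^ 2 + q ^ 2 * cos x ^ 2).
Proof.
intros H; apply is_derive_unique; unfold J; auto_derive.
- simpl in H |- *; lra.
- replace (p * (p * 1) + q * (q * 1) * (cos x * (cos x * 1)))
    with (p ^ 2 + q ^ 2 * cos x ^ 2) by ring.
  field; apply Rgt_not_eq, sqrt_lt_R0, H.
Qed.

Lemma Derive_J_u (lambda x y p q : R) : 0 < p ^ 2 + q ^ 2 * cos x ^ 2 ->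
  Derive (fun x => J lambda x y p q) x
  = cos x * sqrt (p ^ 2 + q ^ 2 * cos x ^ 2)
    - (sin x + lambda) * q ^ 2 * cos x * sin x / sqrt (p ^ 2 + q ^ 2 * cos x ^ 2).
Proof.
intros H; apply is_derive_unique; unfold J; auto_derive.
- simpl in H |- *; lra.
- replace (p * (p * 1) + q * (q * 1) * (cos x * (cos x * 1)))
    with (p ^ 2 + q ^ 2 * cos x ^ 2) by ring.
  field; apply Rgt_not_eq, sqrt_lt_R0, H.
Qed.

Lemma continuous_speed_sq (u v : R -> R) (t : R) :
  C2_at u t -> C2_at v t -> continuous (speed_sq u v) t.
Proof.
intros Hu Hv.
destruct (locally_singleton _ _ Hu) as [Hu1 [Hu2 _]].
destruct (locally_singleton _ _ Hv) as [Hv1 [Hv2 _]].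
apply (@ex_derive_continuous R_AbsRing R_NormedModule).
unfold speed_sq; auto_derive; tauto.
Qed.

(** The momenta are to be differentiated, so their closed forms are needed near [t] and not only at
    [t]. *)
Lemma locally_speed_sq_pos (u v : R -> R) (t : R) :
  C2_at u t -> C2_at v t -> 0 < speed_sq u v t ->
  locally t (fun s => 0 < speed_sq u v s).
Proof.
intros Hu Hv H.
exact (continuous_speed_sq u v t Hu Hv _ (open_gt 0 _ H)).
Qed.

(** The derivative of w u' / E is split as the force term plus a remainder, so that the first
    equation says exactly that the remainder vanishes. *)
Lemma is_derive_momentum_u (lambda : R) (u v : R -> R) (t : R) :
  C2_at u t -> C2_at v t -> 0 < speed_sq u v t ->
  is_derive (fun s => Derive (fun p => J lambda (u s) (v s) p (Derive v s)) (Derive u s)) t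
    (Derive (fun w => J lambda w (v t) (Derive u t) (Derive v t)) (u t)
     + Derive v t * cos (u t) * EL_defect lambda u v t / sqrt (speed_sq u v t) ^ 3).
Proof.
intros Hu Hv Hpos.
destruct (locally_singleton _ _ Hu) as [Hu1 [Hu2 _]].
destruct (locally_singleton _ _ Hv) as [Hv1 [Hv2 _]].
apply (is_derive_ext_loc
  (fun s => (sin (u s) + lambda) * Derive u s
            / sqrt (Derive u s ^ 2 + Derive v s ^ 2 * cos (u s) ^ 2))).
{ generalize (locally_speed_sq_pos u v t Hu Hv Hpos); apply filter_imp; intros s Hs.
  symmetry; apply Derive_J_p, Hs. }
rewrite Derive_J_u by exact Hpos.
unfold EL_defect, curvature_num.
assert (HS : 0 < sqrt (speed_sq u v t)) by (apply sqrt_lt_R0, Hpos).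
assert (HSS : sqrt (speed_sq u v t) ^ 2 = speed_sq u v t) by (apply pow2_sqrt; lra).
unfold speed_sq in *.
auto_derive.
- simpl in Hpos, HS |- *; repeat split; try assumption; lra.
- change (fun x => u x) with u; change (fun x => v x) with v;
  change (fun x => Derive u x) with (Derive u);
  change (fun x => Derive v x) with (Derive v).
  replace (Derive u t * (Derive u t * 1)
           + Derive v t * (Derive v t * 1) * (cos (u t) * (cos (u t) * 1)))
    with (Derive u t ^ 2 + Derive v t ^ 2 * cos (u t) ^ 2) by ring.
  revert HS HSS; generalize (sqrt (Derive u t ^ 2 + Derive v t ^ 2 * cos (u t) ^ 2)).
  intros S HS HSS; rewrite <- HSS.
  assert (HS0 : S <> 0) by lra.
  apply Rminus_diag_uniq.
  field_simplify_eq; [|assumption].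
  (* With [S] for the speed, the claim is a polynomial identity modulo the relation defining [S],
     used here to eliminate u'^2. *)
  assert (HU : Derive u t ^ 2 = S ^ 2 - Derive v t ^ 2 * cos (u t) ^ 2) by lra.
  ring [HU].
Qed.

(** There is no force term, because [J] does not depend on v. Hence this momentum is conserved
    wherever D = 0. *)
Lemma is_derive_momentum_v (lambda : R) (u v : R -> R) (t : R) :
  C2_at u t -> C2_at v t -> 0 < speed_sq u v t ->
  is_derive (fun s => Derive (fun q => J lambda (u s) (v s) (Derive u s) q) (Derive v s)) t
    (- (Derive u t * cos (u t) * EL_defect lambda u v t) / sqrt (speed_sq u v t) ^ 3).
Proof.
intros Hu Hv Hpos.
destruct (locally_singleton _ _ Hu) as [Hu1 [Hu2 _]].
destruct (locally_singleton _ _ Hv) as [Hv1 [Hv2 _]].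
apply (is_derive_ext_loc
  (fun s => (sin (u s) + lambda) * Derive v s * cos (u s) ^ 2
            / sqrt (Derive u s ^ 2 + Derive v s ^ 2 * cos (u s) ^ 2))).
{ generalize (locally_speed_sq_pos u v t Hu Hv Hpos); apply filter_imp; intros s Hs.
  symmetry; apply Derive_J_q, Hs. }
unfold EL_defect, curvature_num.
assert (HS : 0 < sqrt (speed_sq u v t)) by (apply sqrt_lt_R0, Hpos).
assert (HSS : sqrt (speed_sq u v t) ^ 2 = speed_sq u v t) by (apply pow2_sqrt; lra).
unfold speed_sq in *.
auto_derive.
- simpl in Hpos, HS |- *; repeat split; try assumption; lra.
- change (fun x => u x) with u; change (fun x => v x) with v;
  change (fun x => Derive u x) with (Derive u);
  change (fun x => Derive v x) with (Derive v).
  replace (Derive u t * (Derive u t * 1)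
           + Derive v t * (Derive v t * 1) * (cos (u t) * (cos (u t) * 1)))
    with (Derive u t ^ 2 + Derive v t ^ 2 * cos (u t) ^ 2) by ring.
  revert HS HSS; generalize (sqrt (Derive u t ^ 2 + Derive v t ^ 2 * cos (u t) ^ 2)).
  intros S HS HSS; rewrite <- HSS.
  assert (HS0 : S <> 0) by lra.
  apply Rminus_diag_uniq.
  field_simplify_eq; [|assumption].
  assert (HU : Derive u t ^ 2 = S ^ 2 - Derive v t ^ 2 * cos (u t) ^ 2) by lra.
  ring [HU].
Qed.

(** By uniqueness of derivatives the two equations become v' c D = 0 and u' c D = 0. If c D were
    nonzero, u' and v' would both vanish, against positive speed. *)
Lemma EL_pointwise (lambda : R) (u v : R -> R) (t : R) :
  C2_at u t -> C2_at v t -> 0 < speed_sq u v t ->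
  (is_derive (fun s => Derive (fun p => J lambda (u s) (v s) p (Derive v s)) (Derive u s)) t
     (Derive (fun w => J lambda w (v t) (Derive u t) (Derive v t)) (u t))
   /\
   is_derive (fun s => Derive (fun q => J lambda (u s) (v s) (Derive u s) q) (Derive v s)) t
     (Derive (fun w => J lambda (u t) w (Derive u t) (Derive v t)) (v t)))
  <-> cos (u t) * EL_defect lambda u v t = 0.
Proof.
intros Hu Hv Hpos.
assert (Dy : Derive (fun w => J lambda (u t) w (Derive u t) (Derive v t)) (v t) = 0)
  by (unfold J; apply Derive_const).
generalize (is_derive_momentum_u lambda u v t Hu Hv Hpos)
  (is_derive_momentum_v lambda u v t Hu Hv Hpos).
rewrite Dy; intros Mu Mv.
assert (HS : 0 < sqrt (speed_sq u v t) ^ 3) by (apply pow_lt, sqrt_lt_R0, Hpos).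
split.
- intros [E1 E2].
  generalize (is_derive_unique _ _ _ Mu); rewrite (is_derive_unique _ _ _ E1).
  generalize (is_derive_unique _ _ _ Mv); rewrite (is_derive_unique _ _ _ E2).
  unfold speed_sq in Hpos.
  generalize (Derive (fun w => J lambda w (v t) (Derive u t) (Derive v t)) (u t)).
  intros l H2 H1.
  assert (H1' : Derive v t * cos (u t) * EL_defect lambda u v t = 0).
  { apply (Rmult_eq_reg_r (/ sqrt (speed_sq u v t) ^ 3)).
    - unfold Rdiv in H1; lra.
    - apply Rinv_neq_0_compat; lra. }
  assert (H2' : - (Derive u t * cos (u t) * EL_defect lambda u v t) = 0).
  { apply (Rmult_eq_reg_r (/ sqrt (speed_sq u v t) ^ 3)).
    - unfold Rdiv in H2; lra.
    - apply Rinv_neq_0_compat; lra. }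
  destruct (Req_dec (cos (u t) * EL_defect lambda u v t) 0) as [H|H]; [exact H|].
  exfalso.
  assert (HV : Derive v t = 0) by (apply (Rmult_eq_reg_r (cos (u t) * EL_defect lambda u v t)); lra).
  assert (HU : Derive u t = 0) by (apply (Rmult_eq_reg_r (cos (u t) * EL_defect lambda u v t)); lra).
  rewrite HU, HV in Hpos; lra.
- intros H; split.
  + replace (Derive v t * cos (u t) * EL_defect lambda u v t) with 0 in Mu
      by (rewrite Rmult_assoc, H; ring).
    unfold Rdiv in Mu; rewrite Rmult_0_l, Rplus_0_r in Mu; exact Mu.
  + replace (Derive u t * cos (u t) * EL_defect lambda u v t) with 0 in Mv
      by (rewrite Rmult_assoc, H; ring).
    unfold Rdiv in Mv; rewrite Ropp_0, Rmult_0_l in Mv; exact Mv.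
Qed.

(** * From a point to open segments, and continuity of K and D *)

Lemma locally_segment_interior (a b t : R) (P : R -> Prop) :
  a < b -> a <= t <= b -> locally t P ->
  exists c d, a < c /\ c < d /\ d < b /\ forall s, c < s < d -> P s.
Proof.
intros hab Ht [eps HP].
generalize (cond_pos eps); intros Heps.
set (lo := Rmax a (t - eps)); set (hi := Rmin b (t + eps)).
assert (Hlo : a <= lo /\ t - eps <= lo) by (split; [apply Rmax_l | apply Rmax_r]).
assert (Hhi : hi <= b /\ hi <= t + eps) by (split; [apply Rmin_l | apply Rmin_r]).
assert (Hlh : lo < hi) by (apply Rmax_lub_lt; apply Rmin_glb_lt; lra).
(* The middle third of (lo, hi) stays strictly inside (a, b) even when [t] is an endpoint; it need
   not contain [t]. *)
exists ((2 * lo + hi) / 3), ((lo + 2 * hi) / 3).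
repeat split; try lra.
intros s Hs; apply HP.
unfold ball; simpl; unfold AbsRing_ball, abs, minus, plus, opp; simpl.
apply Rabs_def1; lra.
Qed.

Lemma locally_open_segment (c d t : R) (P : R -> Prop) :
  c < t < d -> (forall s, c < s < d -> P s) -> locally t P.
Proof.
intros Ht HP.
apply (filter_imp (fun s => c < s /\ s < d)); [exact HP|].
apply filter_and; [apply (open_gt c) | apply (open_lt d)]; apply Ht.
Qed.

Lemma locally_neq0 (f : R -> R) (t : R) :
  continuous f t -> f t <> 0 -> locally t (fun s => f s <> 0).
Proof. intros Hf H; exact (Hf _ (open_neq 0 _ H)). Qed.

Lemma continuous_curvature_num (u v : R -> R) (t : R) :
  C2_at u t -> C2_at v t -> continuous (curvature_num u v) t.
Proof.
intros Hu Hv.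
destruct (locally_singleton _ _ Hu) as [Hu1 [Hu2 Hu3]].
destruct (locally_singleton _ _ Hv) as [Hv1 [Hv2 Hv3]].
unfold curvature_num.
(* Second derivatives are merely continuous, so the two terms containing them are isolated; all
   other factors are differentiable. *)
apply (continuous_ext (fun s =>
  Derive (Derive u) s * (Derive v s * cos (u s))
  + (Derive (Derive v) s * - (Derive u s * cos (u s))
  + (2 * Derive u s ^ 2 * Derive v s * sin (u s)
     + Derive v s ^ 3 * cos (u s) ^ 2 * sin (u s))))); [intros s; simpl; ring|].
apply (continuous_plus (U := R_UniformSpace) (V := R_NormedModule)).
{ apply (continuous_mult (K := R_AbsRing) (Derive (Derive u))); [exact Hu3|].
  apply (@ex_derive_continuous R_AbsRing R_NormedModule); auto_derive; tauto. }
apply (continuous_plus (U := R_UniformSpace) (V := R_NormedModule)).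
{ apply (continuous_mult (K := R_AbsRing) (Derive (Derive v))); [exact Hv3|].
  apply (@ex_derive_continuous R_AbsRing R_NormedModule); auto_derive; tauto. }
apply (@ex_derive_continuous R_AbsRing R_NormedModule); auto_derive; tauto.
Qed.

Lemma continuous_EL_defect (lambda : R) (u v : R -> R) (t : R) :
  C2_at u t -> C2_at v t -> continuous (EL_defect lambda u v) t.
Proof.
intros Hu Hv.
destruct (locally_singleton _ _ Hu) as [Hu1 [Hu2 _]].
destruct (locally_singleton _ _ Hv) as [Hv1 [Hv2 _]].
apply (continuous_ext (fun s =>
  (sin (u s) + lambda) * curvature_num u v s
  + - (Derive v s * cos (u s) ^ 2 * speed_sq u v s))); [intros s; unfold EL_defect; simpl; ring|].
apply (continuous_plus (U := R_UniformSpace) (V := R_NormedModule)).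
- apply (continuous_mult (K := R_AbsRing) (fun s => sin (u s) + lambda)).
  + apply (@ex_derive_continuous R_AbsRing R_NormedModule); auto_derive; tauto.
  + apply continuous_curvature_num; assumption.
- apply (@ex_derive_continuous R_AbsRing R_NormedModule).
  unfold speed_sq; auto_derive; tauto.
Qed.

(** * Global arguments on the interval [a, b] *)

Section Catenary.

Variables (lambda a b : R) (u v : R -> R).
Hypotheses (hab : a < b) (hu : C2_on a b u) (hv : C2_on a b v)
  (hplus : forall t, a <= t <= b -> 0 < u t <= PI / 2)
  (hreg : regular_on a b (curve u v)).

Lemma speed_sq_pos (t : R) : a <= t <= b -> 0 < speed_sq u v t.
Proof.
intros Ht.
destruct (locally_singleton _ _ (hu t Ht)) as [Hu1 _].
destruct (locally_singleton _ _ (hv t Ht)) as [Hv1 _].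
generalize (pow2_ge_0 (Derive u t)) (pow2_ge_0 (Derive v t * cos (u t))); intros A B.
assert (HE : speed_sq u v t = Derive u t ^ 2 + (Derive v t * cos (u t)) ^ 2)
  by (unfold speed_sq; ring).
destruct (Rle_lt_dec (speed_sq u v t) 0) as [H|H]; [|exact H].
exfalso; apply (hreg t Ht); rewrite Derive3_curve by assumption.
assert (HU : Derive u t = 0) by (apply Rsqr_0_uniq; unfold Rsqr; lra).
(* At the pole v' itself may be nonzero; only the product v' cos u enters gamma'. *)
assert (HV : Derive v t * cos (u t) = 0) by (apply Rsqr_0_uniq; unfold Rsqr; lra).
unfold vzero; f_equal; [f_equal|].
- ring [HU HV].
- ring [HU HV].
- ring [HU].
Qed.

(** Since u cannot exceed pi/2, an interior passage through the pole would be a maximum of u, with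
    zero speed. *)
Lemma cos_u_pos_interior (t : R) : a < t < b -> 0 < cos (u t).
Proof.
intros Ht.
assert (Ht' : a <= t <= b) by lra.
destruct (hplus t Ht') as [Hu0 Hu1].
destruct (Rle_lt_or_eq_dec _ _ Hu1) as [Hlt|Heq].
{ apply cos_gt_0; lra. }
exfalso.
destruct (locally_singleton _ _ (hu t Ht')) as [Hd _].
assert (HU : Derive u t = 0).
{ rewrite <- (Derive_Reals u t (ex_derive_Reals_0 _ _ Hd)).
  apply (deriv_maximum u a b); try lra.
  intros x Hxa Hxb; rewrite Heq; apply hplus; lra. }
generalize (speed_sq_pos t Ht'); unfold speed_sq.
rewrite HU, Heq, cos_PI2; lra.
Qed.

Lemma catenary_iff_defect :
  extrinsic_spherical_catenary lambda a b u v <->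
  forall t, a <= t <= b -> EL_defect lambda u v t = 0.
Proof.
assert (Hpt := fun t Ht =>
  EL_pointwise lambda u v t (hu t Ht) (hv t Ht) (speed_sq_pos t Ht)).
split.
- intros H t Ht.
  apply NNPP; intros Hne.
  destruct (locally_segment_interior a b t _ hab Ht
    (locally_neq0 _ _ (continuous_EL_defect lambda u v t (hu t Ht) (hv t Ht)) Hne))
    as [c [d [Hac [Hcd [Hdb Hs]]]]].
  (* Any point of the segment would do: there c > 0, so c D = 0 contradicts D <> 0. *)
  set (m := (c + d) / 2).
  assert (Hm : c < m < d) by (unfold m; lra).
  apply (Hs m Hm).
  assert (Hm' : a <= m <= b) by lra.
  destruct (Rmult_integral _ _ (proj1 (Hpt m Hm') (H m Hm'))) as [Hc|Hc]; [|exact Hc].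
  generalize (cos_u_pos_interior m); lra.
- intros H t Ht; apply Hpt; [exact Ht|].
  rewrite H by exact Ht; ring.
Qed.

(** Constant height makes the curve a piece of a parallel: u' = u'' = 0, so regularity gives v' <> 0
    and K = v'^3 c^2 sin u. A parallel strictly between equator and pole is not a geodesic. *)
Lemma parallel_on_segment (c d t : R) :
  a < c -> d < b -> c < t < d ->
  (forall s, c < s < d -> sin (u s) + lambda = 0) ->
  Derive u t = 0 /\ Derive v t <> 0 /\ curvature_num u v t <> 0.
Proof.
intros Hac Hdb Ht H.
assert (Ht' : a <= t <= b) by lra.
assert (Hc : 0 < cos (u t)) by (apply cos_u_pos_interior; lra).
destruct (locally_singleton _ _ (hu t Ht')) as [Hd [Hd2 _]].
assert (HU : forall s, c < s < d -> Derive u s = 0).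
{ intros s Hs.
  assert (Hs' : a <= s <= b) by lra.
  assert (Hcs : 0 < cos (u s)) by (apply cos_u_pos_interior; lra).
  destruct (locally_singleton _ _ (hu s Hs')) as [Hds _].
  assert (D0 : Derive (fun x => sin (u x) + lambda) s = 0).
  { rewrite (Derive_ext_loc _ (fun _ => 0)); [apply Derive_const|].
    apply (locally_open_segment c d); assumption. }
  assert (D1 : Derive (fun x => sin (u x) + lambda) s = cos (u s) * Derive u s).
  { apply is_derive_unique; auto_derive; [tauto|].
    change (fun x => u x) with u; ring. }
  rewrite D0 in D1.
  apply (Rmult_eq_reg_l (cos (u s))); lra. }
assert (HU2 : Derive (Derive u) t = 0).
{ rewrite (Derive_ext_loc _ (fun _ => 0)); [apply Derive_const|].
  apply (locally_open_segment c d); assumption. }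
assert (HV : Derive v t <> 0).
{ intros HV; generalize (speed_sq_pos t Ht'); unfold speed_sq.
  rewrite (HU t Ht), HV; lra. }
split; [exact (HU t Ht)|split; [exact HV|]].
unfold curvature_num; rewrite HU2, (HU t Ht).
assert (Hs : 0 < sin (u t)).
{ generalize (hplus t Ht') PI_RGT_0; intros; apply sin_gt_0; lra. }
replace (_ + _) with (Derive v t ^ 3 * cos (u t) ^ 2 * sin (u t)) by ring.
repeat apply Rmult_integral_contrapositive_currified; lra.
Qed.

(* The curvature equation cleared of denominators, read with [/ 0 = 0]. *)
Definition curvature_equation (t : R) : Prop :=
  (sin (u t) + lambda <> 0 -> EL_defect lambda u v t = 0) /\
  (sin (u t) + lambda = 0 -> curvature_num u v t = 0).

Lemma defect_zero_of_curvature_equation :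
  (forall t, a <= t <= b -> curvature_equation t) ->
  forall t, a <= t <= b -> EL_defect lambda u v t = 0.
Proof.
intros H t Ht.
apply NNPP; intros Hne.
destruct (locally_segment_interior a b t _ hab Ht
  (locally_neq0 _ _ (continuous_EL_defect lambda u v t (hu t Ht) (hv t Ht)) Hne))
  as [c [d [Hac [Hcd [Hdb Hs]]]]].
(* Where w <> 0 the curvature equation gives D = 0, so a segment with D <> 0 lies in the zero set of
   w. *)
assert (Hw : forall s, c < s < d -> sin (u s) + lambda = 0).
{ intros s Hsd; apply NNPP; intros Hw; apply (Hs s Hsd).
  apply H; [lra | exact Hw]. }
assert (Hm : c < (c + d) / 2 < d) by lra.
destruct (parallel_on_segment c d _ Hac Hdb Hm Hw) as [_ [_ HK]].
apply HK, H; [lra | apply Hw, Hm].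
Qed.

(** A Clairaut-type relation: the conserved quantity is the momentum conjugate to the cyclic
    coordinate v. *)
Lemma first_integral (s t : R) :
  (forall r, a <= r <= b -> EL_defect lambda u v r = 0) ->
  a <= s <= b -> a <= t <= b ->
  (sin (u s) + lambda) * Derive v s * cos (u s) ^ 2 / sqrt (speed_sq u v s) =
  (sin (u t) + lambda) * Derive v t * cos (u t) ^ 2 / sqrt (speed_sq u v t).
Proof.
intros H.
assert (Hlt : forall s t, a <= s -> s < t -> t <= b ->
  (sin (u s) + lambda) * Derive v s * cos (u s) ^ 2 / sqrt (speed_sq u v s) =
  (sin (u t) + lambda) * Derive v t * cos (u t) ^ 2 / sqrt (speed_sq u v t)).
{ clear s t; intros s t Hs Hst Ht.
  unfold speed_sq; rewrite <- 2!(Derive_J_q lambda _ (v s));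
    try (apply speed_sq_pos; lra).
  (* The rewriting above puts [v s] in the second slot of [J] on both sides; the side at [t] is
     changed to [v t], so that both are values of one function of time. *)
  rewrite (Derive_J_q lambda (u t) (v s)), <- (Derive_J_q lambda (u t) (v t));
    try (apply speed_sq_pos; lra).
  apply (eq_is_derive
    (fun s => Derive (fun q => J lambda (u s) (v s) (Derive u s) q) (Derive v s)));
    [|exact Hst].
  intros r Hr.
  assert (Hr' : a <= r <= b) by lra.
  generalize (is_derive_momentum_v lambda u v r (hu r Hr') (hv r Hr') (speed_sq_pos r Hr')).
  rewrite H by exact Hr'.
  rewrite Rmult_0_r, Ropp_0; unfold Rdiv; rewrite Rmult_0_l; trivial. }
intros Hs Ht; destruct (Rtotal_order s t) as [Hst|[Hst|Hst]].
- apply Hlt; lra.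
- now rewrite Hst.
- symmetry; apply Hlt; lra.
Qed.

Lemma curvature_equation_of_defect_zero :
  (forall t, a <= t <= b -> EL_defect lambda u v t = 0) ->
  forall t, a <= t <= b -> curvature_equation t.
Proof.
intros H t Ht; split; [intros _; exact (H t Ht)|intros Hw].
apply NNPP; intros HK.
(* The first integral is zero at [t], where w = 0, hence everywhere; c and E are positive in the
   interior and cancel. *)
assert (Hint : forall s, a < s < b -> (sin (u s) + lambda) * Derive v s = 0).
{ intros s Hs.
  assert (Hs' : a <= s <= b) by lra.
  generalize (first_integral s t H Hs' Ht).
  rewrite Hw; unfold Rdiv; rewrite !Rmult_0_l; intros E.
  assert (Hc : 0 < cos (u s) ^ 2) by (apply pow_lt, cos_u_pos_interior, Hs).
  assert (HS : 0 < / sqrt (speed_sq u v s))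
    by (apply Rinv_0_lt_compat, sqrt_lt_R0, speed_sq_pos, Hs').
  apply (Rmult_eq_reg_r (cos (u s) ^ 2)); [|lra].
  apply (Rmult_eq_reg_r (/ sqrt (speed_sq u v s))); lra. }
destruct (locally_segment_interior a b t _ hab Ht
  (locally_neq0 _ _ (continuous_curvature_num u v t (hu t Ht) (hv t Ht)) HK))
  as [c [d [Hac [Hcd [Hdb HKs]]]]].
(* Were v' nonzero somewhere, it would be so on a smaller segment, and w v' = 0 would force w = 0
   there. *)
assert (HV : forall s, c < s < d -> Derive v s = 0).
{ intros s Hs; apply NNPP; intros HV.
  assert (Hs' : a <= s <= b) by lra.
  destruct (locally_singleton _ _ (hv s Hs')) as [_ [Hv2 _]].
  destruct (locally_segment_interior c d s _ Hcd (conj (Rlt_le _ _ (proj1 Hs))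
      (Rlt_le _ _ (proj2 Hs)))
    (locally_neq0 _ _ (@ex_derive_continuous R_AbsRing R_NormedModule _ _ Hv2) HV))
    as [c' [d' [Hcc [Hcd' [Hdd HVs]]]]].
  assert (Hw' : forall r, c' < r < d' -> sin (u r) + lambda = 0).
  { intros r Hr; destruct (Rmult_integral _ _ (Hint r ltac:(lra))) as [E|E]; [exact E|].
    now destruct (HVs r Hr). }
  assert (Hm : c' < (c' + d') / 2 < d') by lra.
  assert (Hm' : a < (c' + d') / 2 < b) by lra.
  revert Hm Hm'; generalize ((c' + d') / 2); intros m Hm Hm'.
  assert (Hm2 : a <= m <= b) by lra.
  (* With w = 0, D reduces to - v' c^2 E^2, which is nonzero. *)
  generalize (H m Hm2); unfold EL_defect; rewrite (Hw' m Hm).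
  rewrite Rmult_0_l, Rminus_0_l; apply Ropp_neq_0_compat.
  generalize (cos_u_pos_interior m Hm') (speed_sq_pos m Hm2); intros Hc HS.
  repeat apply Rmult_integral_contrapositive_currified;
    generalize (HVs m Hm); lra. }
assert (Hm : c < (c + d) / 2 < d) by lra.
apply (HKs _ Hm).
(* The curve is now a meridian on the segment, a great circle, so K = 0 there. *)
assert (HV2 : Derive (Derive v) ((c + d) / 2) = 0).
{ rewrite (Derive_ext_loc _ (fun _ => 0)); [apply Derive_const|].
  apply (locally_open_segment c d); assumption. }
unfold curvature_num; rewrite HV2, (HV _ Hm); ring.
Qed.

(** * Clearing denominators in the curvature equation, and the two equivalences *)

Lemma curvature_equation_iff (t : R) : a <= t <= b ->
  geodesic_curvature (curve u v) t =
    Derive v t * cos (u t) ^ 2 / ((sin (u t) + lambda) * norm3 (Derive3 (curve u v) t))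
  <-> curvature_equation t.
Proof.
intros Ht.
destruct (locally_singleton _ _ (hu t Ht)) as [Hu1 _].
destruct (locally_singleton _ _ (hv t Ht)) as [Hv1 _].
rewrite norm3_Derive3_curve by assumption.
rewrite (geodesic_curvature_curve u v t (hu t Ht) (hv t Ht)).
unfold curvature_equation, EL_defect.
generalize (speed_sq_pos t Ht); intros Hpos.
assert (HS : 0 < sqrt (speed_sq u v t)) by (apply sqrt_lt_R0, Hpos).
assert (HSS : sqrt (speed_sq u v t) ^ 2 = speed_sq u v t) by (apply pow2_sqrt; lra).
(* The third occurrence is the factor E^2 inside D; the first two already stand under a square root.
   Afterwards only the speed remains. *)
rewrite <- HSS at 3.
revert HS; generalize (sqrt (speed_sq u v t)); intros S HS.
assert (HS3 : S ^ 3 <> 0) by (apply pow_nonzero; lra).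
destruct (Req_dec (sin (u t) + lambda) 0) as [Hw|Hw].
(* For w = 0 the right-hand side is a division by zero, with value 0, and the equation reads K / S^3
   = 0. *)
- rewrite Hw, Rmult_0_l; unfold Rdiv; rewrite Rinv_0, Rmult_0_r.
  split.
  + intros E; split; [tauto|intros _].
    apply (Rmult_eq_reg_r (/ S ^ 3)); [lra|apply Rinv_neq_0_compat; lra].
  + intros [_ E]; rewrite E by reflexivity; ring.
- split.
  + intros E; split; [intros _|tauto].
    assert (E' : curvature_num u v t
                 = Derive v t * cos (u t) ^ 2 / ((sin (u t) + lambda) * S) * S ^ 3)
      by (rewrite <- E; field; lra).
    rewrite E'; field; lra.
  + intros [E _]; specialize (E Hw).
    assert (E' : curvature_num u v t
                 = Derive v t * cos (u t) ^ 2 * S ^ 2 / (sin (u t) + lambda)).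
    { apply (Rmult_eq_reg_l (sin (u t) + lambda)); [|exact Hw].
      field_simplify_eq; lra. }
    rewrite E'; field; lra.
Qed.

Lemma catenary_iff_curvature :
  extrinsic_spherical_catenary lambda a b u v <->
  forall t, a <= t <= b ->
    geodesic_curvature (curve u v) t =
      Derive v t * (cos (u t)) ^ 2
      / ((sin (u t) + lambda) * norm3 (Derive3 (curve u v) t)).
Proof.
rewrite catenary_iff_defect; split.
- intros H t Ht; apply curvature_equation_iff; [exact Ht|].
  now apply curvature_equation_of_defect_zero.
- intros H; apply defect_zero_of_curvature_equation.
  intros t Ht; apply curvature_equation_iff; auto.
Qed.

End Catenary.

(* No condition is put on sin u + lambda. Where it vanishes, the quotients are
   read with / 0 = 0, that is as kappa_s = 0; both equivalences still hold. *)
Theorem proposition2p6 (lambda a b : R) (u v : R -> R)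
    (hab : a < b) (hu : C2_on a b u) (hv : C2_on a b v)
    (hplus : forall t, a <= t <= b -> 0 < u t <= PI / 2)
    (hreg : regular_on a b (curve u v)) :
  (extrinsic_spherical_catenary lambda a b u v <->
     forall t, a <= t <= b ->
       geodesic_curvature (curve u v) t =
         Derive v t * (cos (u t)) ^ 2
         / ((sin (u t) + lambda) * norm3 (Derive3 (curve u v) t)))
  /\
  (extrinsic_spherical_catenary lambda a b u v <->
     forall t, a <= t <= b ->
       geodesic_curvature (curve u v) t =
         dot3 (unit_normal (curve u v) t) dz / (sin (u t) + lambda)).
Proof.
assert (H := catenary_iff_curvature lambda a b u v hab hu hv hplus hreg).
assert (Hn : forall t, a <= t <= b ->
  dot3 (unit_normal (curve u v) t) dz / (sin (u t) + lambda) =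
  Derive v t * (cos (u t)) ^ 2 / ((sin (u t) + lambda) * norm3 (Derive3 (curve u v) t))).
{ intros t Ht.
  rewrite dot3_unit_normal_curve
    by (apply (locally_singleton _ _ (hu t Ht)) || apply (locally_singleton _ _ (hv t Ht))).
  (* [Rinv_mult] is unconditional, so the two right-hand sides agree also at zeros of w. *)
  unfold Rdiv; rewrite Rinv_mult; ring. }
split; [exact H|].
rewrite H; split; intros E t Ht; [rewrite Hn | rewrite <- Hn]; auto.
Qed.
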